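(* There does not exist a countable family of clopen graphs on the Baire space $\omega^\omega$ such that every clopen graph on $\omega^\omega$ continuously reduces to some member of the family. However, there exist clopen graphs $U_\alpha$ on $\omega^\omega$, $\alpha<\omega_1$, such that every clopen graph on $\omega^\omega$ continuously embeds into some $U_\alpha$.
   Context: $\omega^\omega$ is the Baire space with its usual product topology. For a topological space $X$, a clopen graph on $X$ is a set $E\subseteq X\times X$ which is symmetric and irreflexive and is clopen relative to $X^2\setminus\Delta$, where $\Delta=\{(x,x):x\in X\}$; equivalently, for all $x\neq y$ in $X$ there are open neighborhoods $U\ni x$, $V\ni y$ with either $U\times V\subseteq E$ or $U\times V\subseteq X^2\setminus E$. For clopen graphs $E_1,E_2$ on spaces $X_1,X_2$, $E_1$ continuously reduces to $E_2$ if there is a continuous map $f:X_1\to X_2$ (not necessarily injective) such that for all $x,y\in X_1$, $(x,y)\in E_1$ iff $(f(x),f(y))\in E_2$. If moreover $f$ is a homeomorphism onto its image, $E_1$ continuously embeds into $E_2$. *)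

(* Defs.v *)
From mathcomp Require Import all_boot.
From mathcomp Require Import all_classical wochoice topology function_spaces.

Set Implicit Arguments.
Unset Strict Implicit.
Unset Printing Implicit Defensive.

Local Open Scope classical_set_scope.

Definition baire_space : topologicalType := {ptws nat -> nat}.

(* The off-diagonal set, seen as a type through [set_type], carries the
   topology induced by the product topology on X * X. *)
Definition clopen_graph (X : topologicalType) (E : set (X * X)) : Prop :=
  [/\ forall x y, E (x, y) -> E (y, x),
      forall x, ~ E (x, x)
    & clopen [set z : set_type (~` @diagonal X) | E (set_val z)]].

Definition is_reduction (X1 X2 : topologicalType) (E1 : set (X1 * X1))
    (E2 : set (X2 * X2)) (f : X1 -> X2) : Prop :=
  forall x y, E1 (x, y) <-> E2 (f x, f y).

Definition homeo_onto_image (X1 X2 : topologicalType) (f : X1 -> X2) : Prop :=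
  continuous f /\
  exists2 g : X2 -> X1, cancel f g & {within range f, continuous g}.

Definition continuously_reduces (X1 X2 : topologicalType)
    (E1 : set (X1 * X1)) (E2 : set (X2 * X2)) : Prop :=
  exists2 f : X1 -> X2, continuous f & is_reduction E1 E2 f.

Definition continuously_embeds (X1 X2 : topologicalType)
    (E1 : set (X1 * X1)) (E2 : set (X2 * X2)) : Prop :=
  exists2 f : X1 -> X2, homeo_onto_image f & is_reduction E1 E2 f.

(* omega_1 is the set of countable ordinals.  A countable ordinal is encoded as
   the isomorphism class of the well-orders of that order type whose underlying
   set is a subset of nat.  In a pair p, p.1 is the underlying set and p.2 the
   (non-strict) order relation; the values of p.2 outside p.1 are irrelevant. *)
Definition nat_suborder : Type := ({pred nat} * rel nat)%type.

Definition order_iso (p q : nat_suborder) : Prop :=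
  exists2 f : nat -> nat, set_bij [set` p.1] [set` q.1] f
    & {in p.1 &, {mono f : m n / p.2 m n >-> q.2 m n}}.

Definition omega1 : Type :=
  {a : set nat_suborder | exists2 p, wo_chain p.2 p.1 & a = order_iso p}.

(* Main.v *)
(* A clopen graph decides every pair of distinct points at a finite level, so
   the tree of pairs of distinct nodes of equal length between which it is still
   undecided is well founded.

   No countable family: such a family would reduce to a single clopen graph [G],
   its disjoint sum.  In the graph diagonal to [G] two points [x] and [y] query
   each other, with [y] announcing longer and longer pairs of [G]-nodes, and are
   joined when [G] turns out to have no edge there.  Given a continuous reduction
   [f] to [G], choose [x] and [y] by turns so that the announced nodes are
   the initial segments of [f x] and [f y]; the turns leave room for the
   continuity modulus of [f], and the outcome contradicts the reduction.

   Universal family: compare the undecided pairs by rank in the well-founded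
   tree, which gives a countable well-order [q].  A point of [universal_graph q]
   lists at level [n] a node and the types (edge, non-edge, or undecided of rank
   in [q]) it forms with finitely many other nodes.  Reading off the types along
   two points, as long as the ranks decrease, ends after finitely many steps, and
   sending a point to its initial segments with their types is an embedding. *)

Require Import Defs.
From mathcomp Require Import all_boot.
From mathcomp Require Import all_classical wochoice topology function_spaces.

Set Implicit Arguments.
Unset Strict Implicit.
Unset Printing Implicit Defensive.

Local Open Scope classical_set_scope.

(** * The topology of the Baire space *)

Lemma eq_mkseqP (x y : nat -> nat) n :
  mkseq x n = mkseq y n <-> forall i, i < n -> x i = y i.
Proof.
split=> [e i lt_in|e]; first by rewrite -(nth_mkseq 0 x lt_in) e nth_mkseq.
by apply/eq_in_map => i; rewrite mem_iota => /e.
Qed.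

Lemma eq_mkseqW (x y : nat -> nat) m n :
  m <= n -> mkseq x n = mkseq y n -> mkseq x m = mkseq y m.
Proof.
by move=> le_mn /eq_mkseqP e; apply/eq_mkseqP => i /leq_trans/(_ le_mn)/e.
Qed.

(** The cylinders at [x] generate a filter converging to [x] in each coordinate, hence in the
    product; conversely a cylinder is a finite intersection of preimages of points. *)
Lemma nbhs_baireP (x : baire_space) (A : set baire_space) :
  nbhs x A <-> exists n, forall y, mkseq y n = mkseq x n -> A y.
Proof.
split=> [|[n nA]].
  pose F : set_system baire_space :=
    [set B | exists n, forall y, mkseq y n = mkseq x n -> B y].
  have FF : Filter F.
    split; first by exists 0.
    - move=> B C [m mB] [n nC]; exists (maxn m n) => y e.
      by split; [apply: mB|apply: nC]; apply: eq_mkseqW e;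
        rewrite ?leq_maxl ?leq_maxr.
    - by move=> B C sBC [n nB]; exists n => y /nB/sBC.
  have /(_ A) : {ptws, F --> (x : nat -> nat)}.
    apply/pointwise_cvgP => i; apply/discrete_cvg.
    by exists i.+1 => y /eq_mkseqP/(_ i (ltnSn i)).
  exact.
have /filterS : [set y : baire_space | mkseq y n = mkseq x n] `<=` A by [].
apply; elim: n {nA} => [|n IHn]; first exact: filterS filterT.
have xn : nbhs x [set y : baire_space | y n = x n].
  exact: (@proj_continuous _ (fun=> nat) n x [set x n] (discrete_set1 _)).
apply: filterS (filterI IHn xn) => y [/eq_mkseqP e yx].
by apply/eq_mkseqP => i; rewrite ltnS leq_eqVlt => /orP[/eqP->|/e].
Qed.

Lemma baire_continuousP (f : baire_space -> baire_space) :
  continuous f <-> forall x n, exists m, forall y,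
    mkseq y m = mkseq x m -> mkseq (f y) n = mkseq (f x) n.
Proof.
split=> [cf x n|cf x A /nbhs_baireP[n nA]].
  have := cf x [set y | mkseq y n = mkseq (f x) n].
  by move=> /(_ _)/nbhs_baireP; apply; apply/nbhs_baireP; exists n.
by have [m mf] := cf x n; apply/nbhs_baireP; exists m => y /mf/nA.
Qed.

Lemma nbhs_baire2P (x y : baire_space) (A : set (baire_space * baire_space)) :
  nbhs (x, y) A <-> exists n, forall x' y',
    mkseq x' n = mkseq x n -> mkseq y' n = mkseq y n -> A (x', y').
Proof.
split=> [[[B C] /= [/nbhs_baireP[m mB] /nbhs_baireP[n nC]] sBCA]|[n nA]].
  exists (maxn m n) => x' y' ex ey; apply: sBCA; split.
    by apply: mB; apply: eq_mkseqW ex; rewrite leq_maxl.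
  by apply: nC; apply: eq_mkseqW ey; rewrite leq_maxr.
exists ([set z | mkseq z n = mkseq x n], [set z | mkseq z n = mkseq y n]).
  by split; apply/nbhs_baireP; exists n.
by case=> x' y' [/= ex ey]; apply: nA.
Qed.

(** Quantifying over the proof [Dv] makes the condition vacuous outside [D]. *)
Lemma nbhs_set_typeP (X : topologicalType) (D : set X) (z : set_type D)
    (A : set (set_type D)) :
  nbhs z A <-> nbhs (set_val z) [set v | forall Dv : v \in D, A (exist _ v Dv)].
Proof.
split=> [[_ /= [[W oW <-] Wz sWA]]|nA].
  have : nbhs (set_val z) W by apply: open_nbhs_nbhs.
  by apply: filterS => v Wv Dv; apply: sWA.
have : nbhs z (set_val @^-1` [set v | forall Dv : v \in D, A (exist _ v Dv)]).
  exact: (@initial_continuous _ _ (set_val : set_type D -> X)).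
by apply: filterS => -[v Dv] /=; apply.
Qed.

Lemma clopenP (X : topologicalType) (A : set X) :
  clopen A <-> forall x, \forall y \near x, A y <-> A x.
Proof.
split=> [[oA cA] x|lA].
  have [Ax|nAx] := pselect (A x).
    by have := open_nbhs_nbhs (conj oA Ax); apply: filterS => y Ay.
  have oCA : open (~` A) by apply: closed_openC.
  by have := open_nbhs_nbhs (conj oCA nAx); apply: filterS => y nAy.
split; first by rewrite openE => x Ax; apply: filterS (lA x) => y [_]; exact.
rewrite -openC openE => x nAx.
by apply: filterS (lA x) => y [yx _] /yx.
Qed.

Lemma clopen_graphP (E : set (baire_space * baire_space)) :
  clopen_graph E <->
  [/\ forall x y, E (x, y) -> E (y, x), forall x, ~ E (x, x) &
      forall x y, x <> y -> exists n, forall x' y',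
        mkseq x' n = mkseq x n -> mkseq y' n = mkseq y n ->
        (E (x', y') <-> E (x, y))].
Proof.
split=> -[symE irrE locE]; split=> //.
  move=> x y nxy; have Dxy : (x, y) \in ~` @diagonal baire_space by rewrite inE.
  move: locE => /clopenP/(_
    (exist (fun v => v \in ~` @diagonal baire_space) (x, y) Dxy))
    /nbhs_set_typeP/nbhs_baire2P[n nE].
  have [k nxyk] : exists k, x k <> y k.
    by apply/existsNP; apply: contra_not nxy => /funext.
  (* Going past [k] keeps the nearby pairs off the diagonal. *)
  exists (maxn n k.+1) => x' y' ex ey.
  have Dxy' : (x', y') \in ~` @diagonal baire_space.
    rewrite inE => /= exy; apply: nxyk.
    have lk : k < maxn n k.+1 by rewrite leq_max ltnSn orbT.
    move/eq_mkseqP: ex => /(_ k lk) <-; move/eq_mkseqP: ey => /(_ k lk) <-.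
    by have -> : x' = y' by [].
  by apply: (nE _ _ _ _ Dxy'); [apply: eq_mkseqW ex|apply: eq_mkseqW ey];
    rewrite leq_maxl.
apply/clopenP => -[[x y] Dxy]; apply/nbhs_set_typeP/nbhs_baire2P.
have nxy : x <> y by move: Dxy; rewrite inE.
by have [n nE] := locE x y nxy; exists n => x' y' ex ey Dxy'; apply: nE.
Qed.

(** * Bar induction *)

Lemma mkseq_cylinder (s : seq nat) : mkseq (nth 0 s) (size s) = s.
Proof. exact: mkseq_nth. Qed.

Lemma cylinder_rcons (x : nat -> nat) (s : seq nat) a :
  mkseq x (size (rcons s a)) = rcons s a <->
  mkseq x (size s) = s /\ x (size s) = a.
Proof.
rewrite size_rcons mkseqS; split=> [|[-> ->]//].
by move=> /rcons_inj[-> ->].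
Qed.

Lemma exists_branch (u : nat -> seq nat) (a : nat -> nat) :
  (forall k, u k.+1 = rcons (u k) (a k)) ->
  exists x : nat -> nat, forall k, mkseq x (size (u k)) = u k.
Proof.
move=> uS; pose m := size (u 0).
have szu k : size (u k) = m + k.
  by elim: k => [|k IHk]; rewrite ?addn0// uS size_rcons IHk addnS.
exists (fun i => if i < m then nth 0 (u 0) i else a (i - m)).
elim=> [|k IHk].
  rewrite -[RHS](mkseq_nth 0); apply/eq_mkseqP => i.
  by rewrite -/m => ->.
by rewrite uS; apply/cylinder_rcons; rewrite IHk szu ltnNge leq_addr addKn.
Qed.

Definition all_edges (E : set (baire_space * baire_space)) (s t : seq nat) :=
  forall x y : baire_space,
    mkseq x (size s) = s -> mkseq y (size t) = t -> E (x, y).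

Definition no_edges (E : set (baire_space * baire_space)) (s t : seq nat) :=
  forall x y : baire_space,
    mkseq x (size s) = s -> mkseq y (size t) = t -> ~ E (x, y).

Lemma all_edges_rcons E s t a b :
  all_edges E s t -> all_edges E (rcons s a) (rcons t b).
Proof. by move=> st x y /cylinder_rcons[xs _] /cylinder_rcons[yt _]; exact: st. Qed.

Lemma no_edges_rcons E s t a b :
  no_edges E s t -> no_edges E (rcons s a) (rcons t b).
Proof. by move=> st x y /cylinder_rcons[xs _] /cylinder_rcons[yt _]; exact: st. Qed.

Lemma all_no_edges E s t : all_edges E s t -> no_edges E s t -> False.
Proof.
move=> ae ne.
by apply: (ne _ _ (mkseq_cylinder s) (mkseq_cylinder t)); apply: ae;
  exact: mkseq_cylinder.
Qed.

(** A failure of [P] would pass to children forever and yield two distinct branches; [E] decides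
    this pair at a finite level, where the first premise on [P] applies. *)
Lemma clopen_graph_bar E (P : seq nat -> seq nat -> Prop) :
  clopen_graph E ->
  (forall s t, all_edges E s t \/ no_edges E s t -> P s t) ->
  (forall s t, size s = size t -> s <> t ->
    (forall a b, P (rcons s a) (rcons t b)) -> P s t) ->
  forall s t, size s = size t -> s <> t -> P s t.
Proof.
move=> /clopen_graphP[_ _ locE] P0 PS s t sz nst; apply: contrapT => nP.
pose ok p := [/\ size p.1 = size p.2, p.1 <> p.2 & ~ P p.1 p.2].
have /choice[F okF] : forall p : seq nat * seq nat, exists c : nat * nat,
    ok p -> ok (rcons p.1 c.1, rcons p.2 c.2).
  move=> [u v]; have [[/= szuv nuv nPuv]|] := pselect (ok (u, v)); last first.
    by exists (0, 0).
  have [a [b nPab]] : exists a b, ~ P (rcons u a) (rcons v b).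
    apply: contrapT => nab; apply: nPuv; apply: PS => // a b.
    by apply: contrapT => nPab; apply: nab; exists a, b.
  exists (a, b); split=> //=; first by rewrite !size_rcons szuv.
  by move=> /rcons_inj[].
pose N k := iter k (fun p => (rcons p.1 (F p).1, rcons p.2 (F p).2)) (s, t).
have okN k : ok (N k) by elim: k => // k /okF.
have [x xN] := @exists_branch (fun k => (N k).1) (fun k => (F (N k)).1)
  (fun=> erefl).
have [y yN] := @exists_branch (fun k => (N k).2) (fun k => (F (N k)).2)
  (fun=> erefl).
have [n nE] : exists n, forall x' y', mkseq x' n = mkseq x n ->
    mkseq y' n = mkseq y n -> (E (x', y') <-> E (x, y)).
  (* The branches differ because they extend [s] and [t], distinct nodes of the same length. *)
  by apply: locE => exy; apply: nst; move: (xN 0) (yN 0); rewrite /= exy sz => <-.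
have szN k : k <= size (N k).1.
  by elim: k => // k IHk; rewrite size_rcons.
have [szn _ nPn] := okN n; apply: nPn; apply: P0.
have near x' y' : mkseq x' (size (N n).1) = (N n).1 ->
    mkseq y' (size (N n).2) = (N n).2 -> (E (x', y') <-> E (x, y)).
  move=> ex ey; apply: nE.
    by apply: eq_mkseqW (szN n) _; rewrite ex xN.
  by apply: (@eq_mkseqW _ _ _ (size (N n).2)); rewrite -?szn// szn ey yN.
have [Exy|nExy] := pselect (E (x, y)).
  by left=> x' y' ex ey; apply/near.
by right=> x' y' ex ey /(near _ _ ex ey).
Qed.

(** The number packed with the pair is padding: it gives every pair infinitely many codes. *)
Definition decode (j : nat) : seq nat * seq nat :=
  if unpickle j is Some p then (p : (seq nat * seq nat) * nat).1
  else ([::], [::]).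
Arguments decode : simpl never.

Lemma decode_unbounded c m : exists2 j, m <= j & decode j = c.
Proof.
pose h (i : 'I_m.+1) := pickle (c, val i : nat).
have h_inj : injective h.
  by move=> i j /(pcan_inj pickleK)[/val_inj].
have [i mi] : exists i, m <= h i.
  apply: contrapT => nh; have hm i : h i < m.
    by rewrite ltnNge; apply/negP => mi; apply: nh; exists i.
  have : injective (fun i => Ordinal (hm i)).
    by move=> i j [/h_inj].
  by move=> /leq_card; rewrite !card_ord ltnn.
by exists (h i); rewrite // /decode pickleK.
Qed.

(** * The diagonal graph *)

(* [x] and [y] query each other: at stage [i], [y i] announces a pair of
   [G]-cylinders and [x (y i)] is the place of the next announcement of [y].
   The announcements have to descend one level at each stage, and the play is
   won as soon as [G] has no edge between the announced cylinders. *)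
Inductive refutes (G : set (baire_space * baire_space)) (x y : nat -> nat) :
    seq nat -> seq nat -> nat -> Prop :=
| refutes_stop u v i : decode (y i) = (u, v) -> no_edges G u v ->
    refutes G x y u v i
| refutes_step u v i a b : decode (y i) = (u, v) ->
    refutes G x y (rcons u a) (rcons v b) (x (y i)) -> refutes G x y u v i.

Lemma refutesE G x y u v i : refutes G x y u v i <->
  decode (y i) = (u, v) /\ (no_edges G u v \/
    exists a b, refutes G x y (rcons u a) (rcons v b) (x (y i))).
Proof.
split=> [|[yi [ne|[a [b r]]]]]; last 2 first.
- exact: refutes_stop.
- exact: refutes_step r.
case=> {u v i} [u v i yi ne|u v i a b yi r]; split=> //; first by left.
by right; exists a, b.
Qed.

Lemma all_edges_refutes G x y u v i :
  all_edges G u v -> ~ refutes G x y u v i.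
Proof.
move=> + r; elim: r => {u v i} [u v i _ ne ae|u v i a b _ _ IH ae].
  exact: all_no_edges ae ne.
by apply: IH; exact: all_edges_rcons.
Qed.

(** By bar induction: between decided cylinders at most the value [y i] matters; otherwise one stage
    reads finitely many values and leads to a child. *)
Lemma refutes_locally_constant G u v x y i :
  clopen_graph G -> size u = size v -> u <> v ->
  exists n, forall x' y', mkseq x' n = mkseq x n -> mkseq y' n = mkseq y n ->
    (refutes G x' y' u v i <-> refutes G x y u v i).
Proof.
move=> cG suv nuv; move: u v suv nuv x y i; apply: (clopen_graph_bar cG).
  move=> u v [ae|ne] x y i.
    by exists 0 => x' y' _ _; split=> /(all_edges_refutes ae).
  exists i.+1 => x' y' _ /eq_mkseqP/(_ i (ltnSn i)) yi.
  by rewrite !refutesE yi; split=> -[? _]; split=> //; left.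
move=> u v _ _ IH x y i.
(* One stage reads [y] at [i] and at [x (y i)], and [x] at [y i]. *)
pose n0 := maxn i.+1 (maxn (y i).+1 (x (y i)).+1).
have near n (x' y' : nat -> nat) : n0 <= n -> mkseq x' n = mkseq x n ->
    mkseq y' n = mkseq y n ->
    [/\ y' i = y i, x' (y i) = x (y i) & y' (x (y i)) = y (x (y i))].
  rewrite !geq_max => /and3P[lei ley lex] /eq_mkseqP ex /eq_mkseqP ey.
  by rewrite !(ex, ey).
have [[a [b yab]]|nab] := pselect (exists a b,
    decode (y (x (y i))) = (rcons u a, rcons v b)); last first.
  exists n0 => x' y' /(near n0)/[apply]-[]// yi xi yxi.
  by rewrite !refutesE yi xi; split=> -[? [ne|[a [b /refutesE[e _]]]]];
    (split; [by []|]); (try by left); case: nab; exists a, b; rewrite -?e ?yxi.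
(* The next announcement leaves only one possible choice of [a] and [b]. *)
have nextE (x1 y1 : nat -> nat) : y1 (x (y i)) = y (x (y i)) ->
    (exists a b, refutes G x1 y1 (rcons u a) (rcons v b) (x (y i))) <->
    refutes G x1 y1 (rcons u a) (rcons v b) (x (y i)).
  move=> e; split=> [[a' [b' r]]|r]; last by exists a, b.
  move: (r) => /refutesE[+ _]; rewrite e yab.
  by move=> -[/rcons_inj[->] /rcons_inj[->]].
have [n nP] := IH a b x y (x (y i)).
exists (maxn n0 n) => x' y' ex ey.
have [yi xi yxi] := near _ _ _ (leq_maxl n0 n) ex ey.
rewrite (refutesE _ x') (refutesE _ x) yi xi !nextE// nP//.
  by apply: eq_mkseqW ex; exact: leq_maxr.
by apply: eq_mkseqW ey; exact: leq_maxr.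
Qed.

(** The values at [0] separate the two roles, and [x 1] is the place of the first announcement.
    Announcing two empty nodes always gives an edge; this excludes reductions that are constant on
    the second role. *)
Definition diagonal_edge G (x y : nat -> nat) : Prop :=
  [/\ x 0 = 0, y 0 = 1 & decode (y (x 1)) = ([::], [::]) \/
    exists u v, [/\ decode (y (x 1)) = (u, v), size u = size v, u <> v
      & refutes G x y u v (x 1)]].

Definition diagonal_graph G : set (baire_space * baire_space) :=
  [set p | diagonal_edge G p.1 p.2 \/ diagonal_edge G p.2 p.1].

Lemma diagonal_edge_locally_constant G x y : clopen_graph G ->
  exists n, forall x' y', mkseq x' n = mkseq x n -> mkseq y' n = mkseq y n ->
    (diagonal_edge G x' y' <-> diagonal_edge G x y).
Proof.
move=> cG; case yi: (decode (y (x 1))) => [u v].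
have [n nP] : exists n, forall x' y',
    mkseq x' n = mkseq x n -> mkseq y' n = mkseq y n ->
    ([/\ size u = size v, u <> v & refutes G x' y' u v (x 1)] <->
     [/\ size u = size v, u <> v & refutes G x y u v (x 1)]).
  have [[suv nuv]|nsuv] := pselect (size u = size v /\ u <> v).
    have [n nP] := refutes_locally_constant x y (x 1) cG suv nuv.
    exists n => x' y' ex ey; have r := nP _ _ ex ey.
    by split=> -[_ _ /r].
  by exists 0 => x' y' _ _; split=> -[? ? _]; case: nsuv.
(* Two values fix the roles and [x 1]; [(x 1).+1] values fix the first announcement. *)
exists (maxn n (maxn 2 (x 1).+1)) => x' y' ex ey.
have {nP} := nP x' y' (eq_mkseqW (leq_maxl _ _) ex) (eq_mkseqW (leq_maxl _ _) ey).
move/(eq_mkseqW (leq_maxr _ _))/eq_mkseqP: ex => ex.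
move/(eq_mkseqW (leq_maxr _ _))/eq_mkseqP: ey => ey.
have ex01 : x' 0 = x 0 /\ x' 1 = x 1 by split; apply: ex; rewrite leq_max.
have ey0 : y' 0 = y 0 /\ y' (x 1) = y (x 1).
  by split; apply: ey; rewrite leq_max ?ltnSn ?orbT.
have edgeE (x1 y1 : nat -> nat) : x1 1 = x 1 -> y1 (x 1) = y (x 1) ->
    diagonal_edge G x1 y1 <-> [/\ x1 0 = 0, y1 0 = 1 & (u, v) = ([::], [::]) \/
      [/\ size u = size v, u <> v & refutes G x1 y1 u v (x 1)]].
  move=> e1 e2; rewrite /diagonal_edge e1 e2 yi.
  split=> -[-> -> [e|r]]; split=> //; try by left.
    by case: r => u' [v' [[<- <-] ? ? ?]]; right.
  by case: r => ? ? ?; right; exists u, v.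
case: ex01 ey0 => e0 e1 [e2 e3]; rewrite (edgeE x' y')// (edgeE x y)// e0 e2.
by move=> r; split=> -[-> -> [?|/r ?]]; split=> //; (try by left); right.
Qed.

Lemma diagonal_graph_clopen G : clopen_graph G -> clopen_graph (diagonal_graph G).
Proof.
move=> cG; apply/clopen_graphP; split.
- by move=> x y [] ?; [right|left].
- by move=> x [] [/= -> ?].
move=> x y _; have [m mP] := diagonal_edge_locally_constant x y cG.
have [n nP] := diagonal_edge_locally_constant y x cG.
exists (maxn m n) => x' y' ex ey; rewrite /diagonal_graph /=.
have eW z z' := @eq_mkseqW z z' _ _ (leq_maxl m n).
have eW' z z' := @eq_mkseqW z z' _ _ (leq_maxr m n).
by rewrite (mP x' y' (eW _ _ ex) (eW _ _ ey)) (nP y' x' (eW' _ _ ey) (eW' _ _ ex)).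
Qed.

Definition update (x : nat -> nat) j a : nat -> nat :=
  fun i => if i == j then a else x i.

Lemma mkseq_update x j a n : n <= j -> mkseq (update x j a) n = mkseq x n.
Proof.
move=> nj; apply/eq_mkseqP => i lt_in; rewrite /update ltn_eqF//.
exact: leq_trans nj.
Qed.

Lemma updateE x j a : update x j a j = a.
Proof. by rewrite /update eqxx. Qed.

(** The first [nx] values of [x] and [ny] values of [y] are committed and force [u] and [v]; later
    values are free. At a decided pair, announcing it gives an outcome that contradicts [G]; at
    other pairs the play is prolonged by one stage. *)
Lemma refutes_trap G (f : baire_space -> baire_space) u v x y nx ny i :
  clopen_graph G -> continuous f -> size u = size v -> u <> v ->
  ny <= i ->
  (forall x', mkseq x' nx = mkseq x nx -> mkseq (f x') (size u) = u) ->
  (forall y', mkseq y' ny = mkseq y ny -> mkseq (f y') (size v) = v) ->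
  ~ (forall x' y', mkseq x' nx = mkseq x nx -> mkseq y' ny = mkseq y ny ->
    decode (y' i) = (u, v) -> (G (f x', f y') <-> refutes G x' y' u v i)).
Proof.
move=> cG /baire_continuousP cf suv nuv; move: u v suv nuv x y nx ny i.
apply: (clopen_graph_bar cG).
  move=> u v dec x y nx ny i nyi fx fy.
  have [j nxj ju] := decode_unbounded (u, v) nx.
  move=> /(_ x (update y i j) erefl (mkseq_update _ _ nyi)).
  rewrite updateE => /(_ ju) Guv.
  have fx' := fx x erefl; have fy' := fy _ (mkseq_update y j nyi).
  case: dec => [ae|ne].
    exact/(all_edges_refutes ae)/Guv/ae.
  by apply: (ne _ _ fx' fy'); apply/Guv/refutes_stop => //; rewrite updateE.
move=> u v _ _ IH x y nx ny i nyi fx fy status.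
(* The code [j] is at least [nx], so the answer of [x] at [j] is still free. *)
have [j nxj ju] := decode_unbounded (u, v) nx.
pose y1 : baire_space := update y i j.
have [m mf] := cf y1 (size v).+1.
(* The next announcement is placed beyond the values of [y1] that force one more value of [f y1]. *)
pose ny1 := maxn m (maxn ny i.+1).
have [lem leny lei] : [/\ m <= ny1, ny <= ny1 & i < ny1].
  by rewrite !leq_max !leqnn !orbT.
pose x1 : baire_space := update x j ny1.
have [m' m'f] := cf x1 (size u).+1.
pose nx1 := maxn m' (maxn nx j.+1).
have [lem' lenx lej] : [/\ m' <= nx1, nx <= nx1 & j < nx1].
  by rewrite !leq_max !leqnn !orbT.
have toy y' : mkseq y' ny1 = mkseq y1 ny1 -> mkseq y' ny = mkseq y ny.
  by move/(eq_mkseqW leny)->; exact: mkseq_update.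
have tox x' : mkseq x' nx1 = mkseq x1 nx1 -> mkseq x' nx = mkseq x nx.
  by move/(eq_mkseqW lenx)->; exact: mkseq_update.
apply: (IH (f x1 (size u)) (f y1 (size v)) x1 y1 nx1 ny1 ny1 (leqnn _)).
- move=> x' ex; apply/cylinder_rcons; split; first exact/fx/tox.
  by have /eq_mkseqP := m'f x' (eq_mkseqW lem' ex); exact.
- move=> y' ey; apply/cylinder_rcons; split; first exact/fy/toy.
  by have /eq_mkseqP := mf y' (eq_mkseqW lem ey); exact.
move=> x' y' ex ey y'n.
have y'i : y' i = j by move/eq_mkseqP: ey => /(_ i lei) ->; exact: updateE.
have x'j : x' j = ny1 by move/eq_mkseqP: ex => /(_ j lej) ->; exact: updateE.
have {status} Gr := status x' y' (tox _ ex) (toy _ ey) _.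
rewrite Gr ?y'i// refutesE y'i x'j; split=> [[_ [ne|[a [b r]]]]|r].
(* Without edges between the cylinders the play is won at once, and [Gr] would join the images. *)
- exfalso; apply: (ne _ _ (fx _ (tox _ ex)) (fy _ (toy _ ey))).
  by apply/Gr; [rewrite y'i|apply: refutes_stop; rewrite ?y'i].
- move: (r) => /refutesE[+ _]; rewrite y'n.
  by move=> -[/rcons_inj[->] /rcons_inj[->]].
- by split=> //; right; exists (f x1 (size u)), (f y1 (size v)).
Qed.

(** If [x 1] lies beyond a modulus of [f] at [y], the trap forces [f x] and [f y] to agree up to the
    corresponding length. Hence [f] is constant on the second role, although points of that role
    differ in their edges. *)
Lemma diagonal_graph_not_reducible G :
  clopen_graph G -> ~ continuously_reduces (diagonal_graph G) G.
Proof.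
move=> cG [f /[dup] cf' /baire_continuousP cf red].
have redE x y : x 0 = 0 -> y 0 = 1 -> G (f x, f y) <-> diagonal_edge G x y.
  move=> x0 y0; rewrite -red /diagonal_graph /=; split=> [[//|]|]; last by left.
  by move=> [/=]; rewrite y0.
have start y ny n x : y 0 = 1 -> 0 < ny -> x 0 = 0 -> ny <= x 1 ->
    (forall y', mkseq y' ny = mkseq y ny -> mkseq (f y') n = mkseq (f y) n) ->
    mkseq (f x) n = mkseq (f y) n.
  move=> y0 ny0 x0 nyx fy; apply: contrapT => nuv.
  have [m mf] := cf x n.
  apply: (@refutes_trap G f _ _ x y (maxn m 2) ny (x 1) cG cf' _ nuv nyx).
  - by rewrite !size_mkseq.
  - by move=> x' /(eq_mkseqW (leq_maxl _ _)); rewrite size_mkseq; exact: mf.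
  - by move=> y'; rewrite size_mkseq; exact: fy.
  move=> x' y' /(eq_mkseqW (leq_maxr _ _))/eq_mkseqP ex /eq_mkseqP ey y'x.
  have x'0 : x' 0 = 0 by rewrite ex.
  have y'0 : y' 0 = 1 by rewrite ey.
  rewrite redE// /diagonal_edge (ex 1 isT) y'x; split=> [[_ _ [[u0 v0]|]]|r].
  - by case: nuv; rewrite u0 v0.
  - by move=> [u [v [[-> ->]]]].
  split=> //; right; exists (mkseq (f x) n), (mkseq (f y) n).
  by rewrite !size_mkseq.
have fconst y y' : y 0 = 1 -> y' 0 = 1 -> f y = f y'.
  move=> y0 y'0; apply/funext => k.
  have [m mf] := cf y k.+1; have [m' m'f] := cf y' k.+1.
  (* One [x] whose place clears both moduli compares [y] with [y']. *)
  pose x : baire_space := update (fun=> 0) 1 (maxn m m').+1.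
  suff : mkseq (f y) k.+1 = mkseq (f y') k.+1 by move/eq_mkseqP; exact.
  have := start y (maxn m m').+1 k.+1 x y0 isT erefl (leqnn _).
  move=> <-; last by move=> z ez; apply: mf; apply: eq_mkseqW ez;
    rewrite leqW// leq_maxl.
  apply: (start y' (maxn m m').+1 k.+1 x y'0 isT erefl (leqnn _)).
  by move=> z ez; apply: m'f; apply: eq_mkseqW ez; rewrite leqW// leq_maxr.
have [j _ j0] := decode_unbounded ([::], [::]) 0.
(* Announcing nodes of different lengths yields no edge. *)
have [j' _ j'0] := decode_unbounded ([::], [:: 0]) 0.
pose x : baire_space := update (fun=> 0) 1 2.
pose y a : baire_space := update (fun=> 1) 2 a.
have : diagonal_edge G x (y j) by split=> //; left.
move/redE => /(_ erefl erefl); rewrite (fconst (y j) (y j') erefl erefl).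
move/redE => /(_ erefl erefl) [_ _].
rewrite (_ : decode _ = ([::], [:: 0]))// => -[//|[u [v [[<- <-]]]]].
by [].
Qed.

(** * Disjoint sum of a countable family *)

Lemma countable_family_bound (F : set (set (baire_space * baire_space))) :
  countable F -> (forall E, F E -> clopen_graph E) ->
  exists2 G : set (baire_space * baire_space), clopen_graph G &
    forall E, F E -> continuously_reduces E G.
Proof.
move=> /countable_injP[g g_inj] cF.
pose tail (x : baire_space) : baire_space := fun i => x i.+1.
pose G : set (baire_space * baire_space) := [set p | p.1 0 = p.2 0 /\
  exists E, [/\ F E, g E = p.1 0 & E (tail p.1, tail p.2)]].
have GE (E : set (baire_space * baire_space)) (x y : baire_space) :
    F E -> x 0 = g E -> y 0 = g E -> G (x, y) <-> E (tail x, tail y).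
  move=> FE x0 y0; rewrite /G /= x0 y0; split=> [[_ [E' [FE' gE' ]]]|Exy].
    by rewrite (g_inj E' E) ?inE.
  by split=> //; exists E.
have tailP n (x x' : baire_space) : mkseq x' n.+1 = mkseq x n.+1 ->
    x' 0 = x 0 /\ mkseq (tail x') n = mkseq (tail x) n.
  move/eq_mkseqP => e; split; first exact: e.
  by apply/eq_mkseqP => i lt_in; exact: (e i.+1).
exists G.
  apply/clopen_graphP; split.
  - move=> x y [/= xy0 [E [FE gE Exy]]]; split=> //=; exists E.
    by split; rewrite -?xy0//; have /clopen_graphP[+ _ _] := cF E FE; apply.
  - by move=> x [_ [E [FE _]]]; have /clopen_graphP[_ + _] := cF E FE; apply.
  move=> x y nxy; have [xy0|nxy0] := pselect (x 0 = y 0); last first.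
    exists 1 => x' y' /tailP[x'0 _] /tailP[y'0 _].
    by rewrite /G /= x'0 y'0; split=> -[].
  (* Points whose first value codes no member of [F] have no edges. *)
  have [[E FE gE]|nE] := pselect (exists2 E, F E & g E = x 0); last first.
    exists 1 => x' y' /tailP[x'0 _] /tailP[y'0 _].
    by rewrite /G /= x'0 y'0; split=> -[_ [E [? ? _]]]; case: nE; exists E.
  have /clopen_graphP[_ _ /(_ (tail x) (tail y))[|n nE]] := cF E FE.
    move=> e; apply: nxy; apply/funext => -[//|i].
    exact: (congr1 (fun z : nat -> nat => z i) e).
  exists n.+1 => x' y' /tailP[x'0 ex] /tailP[y'0 ey].
  by rewrite !(GE E)// ?x'0 ?y'0 -?xy0//; exact: nE.
move=> E FE; exists (fun x i => if i is j.+1 then x j else g E).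
  apply/baire_continuousP => x n; exists n => y /eq_mkseqP e.
  by apply/eq_mkseqP => -[//|i] /ltnW; exact: e.
by move=> x y; rewrite (GE E).
Qed.

Lemma no_countable_universal (F : set (set (baire_space * baire_space))) :
  countable F -> (forall E, F E -> clopen_graph E) ->
  ~ forall E : set (baire_space * baire_space), clopen_graph E ->
      exists2 E', F E' & continuously_reduces E E'.
Proof.
move=> /countable_family_bound/[apply]-[G cG FG].
move=> /(_ _ (diagonal_graph_clopen cG))[E /FG[h ch hred] [f cf fred]].
apply: (diagonal_graph_not_reducible cG); exists (h \o f).
  by move=> x; apply: continuous_comp; [exact: cf|exact: ch].
by move=> x y; rewrite fred hred.
Qed.

(** * Ranks of well-founded relations and countable ordinals *)

(* For a well-founded relation this compares the ranks of [a] and [b]. *)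
Inductive rank_le (R : nat -> nat -> Prop) (a b : nat) : Prop :=
  RankLe of forall a', R a' a -> exists2 b', R b' b & rank_le R a' b'.

Section RankOrder.
Variable R : nat -> nat -> Prop.
Hypothesis Rwf : well_founded R.

Lemma rank_le_refl a : rank_le R a a.
Proof.
by elim/(well_founded_ind Rwf): a => a IH; split=> a' Ra; exists a'; last exact: IH.
Qed.

Lemma rank_le_trans a b c : rank_le R a b -> rank_le R b c -> rank_le R a c.
Proof.
elim/(well_founded_ind Rwf): a b c => a IH b c [ab] [bc]; split=> a' Ra.
have [b' Rb le_ab] := ab _ Ra; have [c' Rc le_bc] := bc _ Rb.
by exists c' => //; exact: IH le_ab le_bc.
Qed.

Lemma rank_le_total a b : rank_le R a b \/ rank_le R b a.
Proof.
elim/(well_founded_ind Rwf): a b => a IH b.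
have [ab|nab] := pselect (rank_le R a b); [by left|right; split=> b' Rb].
apply: contrapT => nb'; apply: nab; split=> a' Ra; exists b' => //.
by have [//|b'a'] := IH a' Ra b'; case: nb'; exists a'.
Qed.

Lemma rank_lt a b : R a b -> ~ rank_le R b a.
Proof.
elim/(well_founded_ind Rwf): a b => a IH b Rab [ba].
by have [a' Ra'a aa'] := ba _ Rab; exact: IH aa'.
Qed.

Lemma rank_lt_exists a b :
  ~ rank_le R b a -> exists2 b', R b' b & rank_le R a b'.
Proof.
elim/(well_founded_ind Rwf): a b => a IH b nba.
apply: contrapT => nb; apply: nba; split=> b' Rb.
apply: contrapT => na; apply: nb; exists b' => //; split=> a' Ra.
by apply: IH => // b'a'; apply: na; exists a'.
Qed.

(** Induction on a bound [b] of the rank: whatever has rank strictly below [b] is bounded by some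
    [b'] with [R b' b]. *)
Lemma rank_lt_wf : well_founded (fun a b => ~ rank_le R b a).
Proof.
suff H b a : rank_le R a b -> Acc (fun a b => ~ rank_le R b a) a.
  by move=> a; exact: H (rank_le_refl a).
elim/(well_founded_ind Rwf): b a => b IH a ab; split=> c nac.
have [|b' Rb cb'] := @rank_lt_exists c b; last exact: IH cb'.
by move=> bc; apply: nac; exact: rank_le_trans bc.
Qed.

(** Ties of rank are broken by the numerical order, which turns the preorder into a well-order of
    [nat]. *)
Definition rank_order : rel nat :=
  fun m n => `[< rank_le R m n /\ (rank_le R n m -> m <= n) >].

Lemma rank_order_wo : wo_chain rank_order predT.
Proof.
apply: antisymmetric_wo_chain.
  move=> m n _ _ /andP[/asboolP[mn le_mn] /asboolP[nm le_nm]].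
  by apply/eqP; rewrite eqn_leq le_mn ?le_nm.
move=> A _ [a Aa].
have [m Am mP] : exists2 m, m \in A & forall n, n \in A -> rank_le R m n.
  elim/(well_founded_ind rank_lt_wf): a Aa => a IH Aa.
  apply: contrapT => nm; apply: (nm); exists a => // n An; apply: contrapT => nan.
  by apply: nm; exact: IH nan An.
(* Among the elements of least rank, the smallest number is the minimum. *)
have ex : exists n, (n \in A) && `[< rank_le R n m >].
  by exists m; rewrite Am; apply/asboolP/rank_le_refl.
case: (ex_minnP ex) => n /andP[An /asboolP nm] nP; exists n; split=> // k Ak.
apply/asboolP; split; first exact: rank_le_trans nm (mP k Ak).
by move=> kn; apply: nP; rewrite Ak; apply/asboolP; exact: rank_le_trans nm.
Qed.

Lemma rank_order_lt m n : R m n -> rank_order m n /\ m <> n.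
Proof.
move=> Rmn; have nnm := rank_lt Rmn.
split; last by move=> mn; apply: nnm; rewrite mn; exact: rank_le_refl.
by apply/asboolP; split=> //; have [//|/nnm] := rank_le_total m n.
Qed.

End RankOrder.

Definition strictly_below (q : nat_suborder) (m n : nat) : Prop :=
  [/\ m \in q.1, n \in q.1, q.2 m n & m <> n].

Lemma strictly_below_wf (q : nat_suborder) :
  wo_chain q.2 q.1 -> well_founded (strictly_below q).
Proof.
move=> wo; suff H n : n \in q.1 -> Acc (strictly_below q) n.
  by move=> n; split=> m [/H].
move=> qn; apply: contrapT => nacc.
pose A := [pred k | (k \in q.1) && `[< ~ Acc (strictly_below q) k >]].
have sA : {subset A <= q.1} by move=> k /andP[].
have [|m [[/andP[qm /asboolP naccm] mP] _]] := wo A sA.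
  by exists n; rewrite inE qn; apply/asboolP.
apply: naccm; split=> k [qk _ km nkm]; apply: contrapT => nacck; apply: nkm.
apply: (wo_chain_antisymmetric wo qk qm); rewrite km mP//.
by rewrite inE qk; apply/asboolP.
Qed.

(** The ordinal is the type of [rank_order R]. The statement covers every representative [q], since
    an element of [omega1] has no preferred one. *)
Lemma wf_omega1 (R : nat -> nat -> Prop) : well_founded R ->
  exists a : omega1, forall q, wo_chain q.2 q.1 -> proj1_sig a = order_iso q ->
    exists f : nat -> nat, forall m n, R m n -> strictly_below q (f m) (f n).
Proof.
move=> Rwf; pose p : nat_suborder := (predT : {pred nat}, rank_order R).
have pP : exists2 p0 : nat_suborder, wo_chain p0.2 p0.1 & order_iso p = order_iso p0.
  by exists p => //; exact: rank_order_wo.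
exists (exist _ (order_iso p) pP) => q _ /= pq.
have : order_iso p q by rewrite pq; exists id => //; split=> // k qk; exists k.
move=> [f [fq f_inj _] f_mono]; exists f => m n /(rank_order_lt Rwf)[mn nmn].
split; [exact: (fq m)|exact: (fq n)|by rewrite f_mono|].
by move=> /f_inj e; apply: nmn; apply: e; rewrite inE.
Qed.

(** * The universal graphs *)

(* The type of a pair of nodes is [1] if the pair is joined, [0] if it is not,
   and [r.+2] if it is undecided of rank [r]. *)
Definition type_below (q : nat_suborder) (c c' : nat) : Prop :=
  exists2 r', c' = r'.+2 &
    c < 2 \/ exists2 r, c = r.+2 & strictly_below q r r'.

Lemma type_below_wf (q : nat_suborder) :
  wo_chain q.2 q.1 -> well_founded (type_below q).
Proof.
move=> /strictly_below_wf wf.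
have acc01 c : c < 2 -> Acc (type_below q) c.
  by move=> c2; split=> c' [r' cE _]; rewrite cE in c2.
have accr r : Acc (type_below q) r.+2.
  elim/(well_founded_ind wf): r => r IH; split=> c [r' [<-] [/acc01//|]].
  by move=> [k -> /IH].
by case=> [|[|r]]; [exact: acc01|exact: acc01|exact: accr].
Qed.

(** Requiring the types to decrease makes the reading stop on every sequence, even one that comes
    from no graph; this keeps the universal graph clopen. *)
Inductive reaches_edge (q : nat_suborder) (c : nat -> nat) (n : nat) : Prop :=
| reaches_now of c n = 1
| reaches_later of type_below q (c n.+1) (c n) & reaches_edge q c n.+1.

(** Induction on the type [c n]: each step looks only at [c n] and [c n.+1]. *)
Lemma reaches_edge_locally_constant q c n : wo_chain q.2 q.1 ->
  exists m, forall c', mkseq c' m = mkseq c m ->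
    (reaches_edge q c' n <-> reaches_edge q c n).
Proof.
move=> /type_below_wf wf.
suff H d : forall n, c n = d -> exists m, forall c', mkseq c' m = mkseq c m ->
    (reaches_edge q c' n <-> reaches_edge q c n) by exact: H erefl.
elim/(well_founded_ind wf): d => d IH {}n cn.
have [lt|nlt] := pselect (type_below q (c n.+1) (c n)).
  rewrite cn in lt; have [m mP] := IH _ lt n.+1 erefl.
  exists (maxn m n.+2) => c' ec.
  have {}mP := mP c' (eq_mkseqW (leq_maxl _ _) ec).
  have /eq_mkseqP e := eq_mkseqW (leq_maxr _ _) ec.
  have en := e n (leqW (ltnSn n)); have en1 := e n.+1 (ltnSn _).
  split=> -[r1|r1 r2]; try by apply: reaches_now; rewrite -r1.
    by apply: reaches_later; [rewrite -en -en1|apply/mP].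
  by apply: reaches_later; [rewrite en en1|apply/mP].
exists n.+2 => c' /eq_mkseqP e.
have en := e n (leqW (ltnSn n)); have en1 := e n.+1 (ltnSn _).
split=> -[r1|r1 r2]; try by apply: reaches_now; rewrite -r1.
  by rewrite en en1 in r1.
by case: nlt.
Qed.

(* An entry of a point of the universal graph codes a node [s] of [seq nat],
   and the list of the types of (t, s) and (s, t), indexed by the codes of the
   nodes t up to that of [s].  Of two entries the one with the larger code knows
   the type of their pair. *)
Definition entry (j : nat) : nat * seq (nat * nat) :=
  odflt (0, [::]) (unpickle j).

Definition node (b : nat) : seq nat := odflt [::] (unpickle b).

Definition entry_type (j j' : nat) : nat :=
  if (entry j).1 < (entry j').1 then (nth (0, 0) (entry j').2 (entry j).1).1
  else (nth (0, 0) (entry j).2 (entry j').1).2.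

(** The reading starts at the first difference because only pairs of distinct nodes have descending
    ranks. The smaller value there decides which point is read first. *)
Definition universal_arrow q (x y : nat -> nat) : Prop :=
  exists n, [/\ mkseq x n = mkseq y n, x n < y n &
    reaches_edge q (fun m => entry_type (x m) (y m)) n].

Definition universal_graph q : set (baire_space * baire_space) :=
  [set p | universal_arrow q p.1 p.2 \/ universal_arrow q p.2 p.1].

Lemma first_difference (x y : nat -> nat) : x <> y ->
  exists2 n, mkseq x n = mkseq y n & x n <> y n.
Proof.
move=> nxy; have ex : exists n, x n != y n.
  apply: contrapT => nex; apply: nxy; apply/funext => n.
  by apply/eqP/negP => nxyn; apply: nex; exists n; apply/negP.
case: (ex_minnP ex) => n /eqP nxyn nP; exists n => //; apply/eq_mkseqP => i.
by apply: contraTeq => /nP; rewrite -leqNgt.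
Qed.

Lemma first_difference_unique (x y : nat -> nat) m n :
  mkseq x m = mkseq y m -> x m <> y m ->
  mkseq x n = mkseq y n -> x n <> y n -> m = n.
Proof.
move=> /eq_mkseqP em nm /eq_mkseqP en nn.
by case: (ltngtP m n) => // [/en|/em].
Qed.

Lemma universal_arrowE q (x y : nat -> nat) n :
  mkseq x n = mkseq y n -> x n <> y n ->
  universal_arrow q x y <->
    x n < y n /\ reaches_edge q (fun m => entry_type (x m) (y m)) n.
Proof.
move=> e nxy; split=> [[m [em lt r]]|[lt r]]; last by exists n.
rewrite (@first_difference_unique x y n m)//.
by move=> exy; rewrite exy ltnn in lt.
Qed.

Lemma universal_arrow_locally_constant q (x y : nat -> nat) :
  wo_chain q.2 q.1 -> x <> y ->
  exists n, forall x' y', mkseq x' n = mkseq x n -> mkseq y' n = mkseq y n ->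
    (universal_arrow q x' y' <-> universal_arrow q x y).
Proof.
move=> wo /first_difference[n exy nxy].
have [m mP] := reaches_edge_locally_constant
  (fun m => entry_type (x m) (y m)) n wo.
exists (maxn m n.+1) => x' y' ex ey.
have {}mP := mP (fun m => entry_type (x' m) (y' m)).
have e1 : mkseq x' n.+1 = mkseq x n.+1 := eq_mkseqW (leq_maxr _ _) ex.
have e2 : mkseq y' n.+1 = mkseq y n.+1 := eq_mkseqW (leq_maxr _ _) ey.
have xn : x' n = x n by move/eq_mkseqP: e1; exact.
have yn : y' n = y n by move/eq_mkseqP: e2; exact.
rewrite (@universal_arrowE q x' y' n) ?(universal_arrowE _ exy nxy).
- rewrite xn yn mP//; apply/eq_mkseqP => i lt_im.
  have lti : i < maxn m n.+1 by rewrite leq_max lt_im.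
  move/eq_mkseqP: ex => /(_ i lti) ->.
  by move/eq_mkseqP: ey => /(_ i lti) ->.
- by rewrite (eq_mkseqW (leqnSn n) e1) exy (eq_mkseqW (leqnSn n) e2).
- by rewrite xn yn.
Qed.

Lemma universal_graph_clopen q :
  wo_chain q.2 q.1 -> clopen_graph (universal_graph q).
Proof.
move=> wo; apply/clopen_graphP; split.
- by move=> x y [] ?; [right|left].
- by move=> x [] [n []]; rewrite ltnn.
move=> x y nxy; have [m mP] := universal_arrow_locally_constant wo nxy.
have [n nP] := universal_arrow_locally_constant wo (nesym nxy).
exists (maxn m n) => x' y' ex ey; rewrite /universal_graph /=.
have eW z z' := @eq_mkseqW z z' _ _ (leq_maxl m n).
have eW' z z' := @eq_mkseqW z z' _ _ (leq_maxr m n).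
by rewrite (mP x' y' (eW _ _ ex) (eW _ _ ey)) (nP y' x' (eW' _ _ ey) (eW' _ _ ex)).
Qed.

(** * Embedding a clopen graph into a universal one *)

Definition undecided_child E (p' p : seq nat * seq nat) : Prop :=
  [/\ size p.1 = size p.2, p.1 <> p.2,
    exists a b, p' = (rcons p.1 a, rcons p.2 b) &
    ~ (all_edges E p'.1 p'.2 \/ no_edges E p'.1 p'.2)].

(** Decided pairs, pairs of equal nodes and pairs of different lengths have no children; bar
    induction handles the rest. *)
Lemma undecided_child_wf E :
  clopen_graph E -> well_founded (undecided_child E).
Proof.
move=> cE; suff H s t : size s = size t -> s <> t -> Acc (undecided_child E) (s, t).
  by move=> [s t]; split=> p' [/= sz nst [a [b ->]] _]; apply: H;
    [rewrite !size_rcons sz|move/rcons_inj => -[]].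
move: s t; apply: (clopen_graph_bar cE).
  move=> s t dec; split=> p' [/= _ _ [a [b ->]] []] /=.
  by case: dec => [/all_edges_rcons|/no_edges_rcons] ?; [left|right].
by move=> s t _ _ IH; split=> p' [/= _ _ [a [b ->]] _].
Qed.

Section Embedding.
Variables (E : set (baire_space * baire_space)) (q : nat_suborder).
Variable rk : seq nat * seq nat -> nat.
Hypothesis cE : clopen_graph E.
Hypothesis rkP : forall p' p, undecided_child E p' p ->
  strictly_below q (rk p') (rk p).

Definition node_type (s t : seq nat) : nat :=
  if `[< all_edges E s t >] then 1
  else if `[< no_edges E s t >] then 0 else (rk (s, t)).+2.

(** The list reaches index [pickle s] itself, which [entry_type] consults when the two codes are
    equal. *)
Definition node_entry (s : seq nat) : nat :=
  pickle (pickle s, mkseq (fun b => (node_type (node b) s, node_type s (node b)))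
                          (pickle s).+1).

Lemma entry_type_node s t :
  entry_type (node_entry s) (node_entry t) = node_type s t.
Proof.
rewrite /entry_type /entry /node_entry !pickleK /=; case: ltnP => st.
  by rewrite nth_mkseq /node ?pickleK// ltnW.
by rewrite nth_mkseq /node ?pickleK.
Qed.

(** The segment of length [n.+1] contains [x n], so the inverse works coordinate by coordinate and
    is continuous everywhere. *)
Definition embedding (x : baire_space) : baire_space :=
  fun n => node_entry (mkseq x n.+1).

Definition embedding_inv (x : baire_space) : baire_space :=
  fun n => nth 0 (node (entry (x n)).1) n.

Lemma embeddingK : cancel embedding embedding_inv.
Proof.
move=> x; apply/funext => n; rewrite /embedding_inv /embedding /node_entry.
by rewrite /entry pickleK /= /node pickleK /= nth_mkseq.
Qed.

Lemma embedding_homeo : homeo_onto_image embedding.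
Proof.
split.
  apply/baire_continuousP => x n; exists n => y e; apply/eq_mkseqP => i lt_in.
  by rewrite /embedding (eq_mkseqW lt_in e).
exists embedding_inv; first exact: embeddingK.
apply: continuous_subspaceT; apply/baire_continuousP => x n; exists n => y.
move=> /eq_mkseqP e; apply/eq_mkseqP => i lt_in.
by rewrite /embedding_inv e.
Qed.

(** Embedded points carry the true types. Reading [1] certifies an edge; conversely, across an edge
    the type is never [0] and the ranks descend until the cylinders are fully joined. *)
Lemma reaches_edge_embedding (x y : baire_space) n :
  embedding x n <> embedding y n ->
  reaches_edge q (fun m => entry_type (embedding x m) (embedding y m)) n <->
  E (x, y).
Proof.
move=> nxyn; have {nxyn} nst : mkseq x n.+1 <> mkseq y n.+1.
  by apply: contra_not nxyn => e; rewrite /embedding e.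
have -> : (fun m => entry_type (embedding x m) (embedding y m)) =
    (fun m => node_type (mkseq x m.+1) (mkseq y m.+1)).
  by apply/funext => m; exact: entry_type_node.
split=> [|Exy].
  elim=> {nst}// m; rewrite /node_type; case: asboolP => [ae _|_].
    by apply: ae; rewrite size_mkseq.
  by case: asboolP.
have [k kE] : exists k, forall m, k <= m ->
    all_edges E (mkseq x m.+1) (mkseq y m.+1).
  have /clopen_graphP[_ _ locE] := cE.
  have [|k kE] := locE x y; first by move=> xy; apply: nst; rewrite xy.
  exists k => m km x' y'; rewrite !size_mkseq => ex ey.
  by apply/kE => //; [apply: eq_mkseqW ex|apply: eq_mkseqW ey]; exact: leqW.
have nne m : ~ no_edges E (mkseq x m.+1) (mkseq y m.+1).
  by move=> ne; apply: (ne x y); rewrite ?size_mkseq.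
have typeE m : node_type (mkseq x m.+1) (mkseq y m.+1) =
    if `[< all_edges E (mkseq x m.+1) (mkseq y m.+1) >] then 1
    else (rk (mkseq x m.+1, mkseq y m.+1)).+2.
  by rewrite /node_type; case: asboolP => // _; case: asboolP => // /nne.
(* [d] bounds the number of levels left before [k]. *)
have [d kd] : exists d, k <= n + d by exists k; exact: leq_addl.
elim: d n nst kd => [|d IH] n nst kd.
  apply: reaches_now; rewrite typeE; case: asboolP => // -[].
  by apply: kE; rewrite -[n]addn0.
have sz m : size (mkseq x m) = size (mkseq y m) by rewrite !size_mkseq.
have [ae|nae] := pselect (all_edges E (mkseq x n.+1) (mkseq y n.+1)).
  by apply: reaches_now; rewrite typeE asboolT.
have below m : ~ all_edges E (mkseq x m.+2) (mkseq y m.+2) ->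
    mkseq x m.+1 <> mkseq y m.+1 ->
    strictly_below q (rk (mkseq x m.+2, mkseq y m.+2))
                     (rk (mkseq x m.+1, mkseq y m.+1)).
  move=> nae' nst'; apply: rkP; split; [exact: sz|exact: nst'| |].
    by exists (x m.+1), (y m.+1); rewrite -!mkseqS.
  by case=> [//|/nne].
apply: reaches_later; last first.
  by apply: IH; [apply: contra_not nst; exact: eq_mkseqW|rewrite addSnnS].
rewrite !typeE (asboolF nae); exists (rk (mkseq x n.+1, mkseq y n.+1)) => //.
case: asboolP => [_|nae']; first by left.
by right; exists (rk (mkseq x n.+2, mkseq y n.+2)); last exact: below.
Qed.

(** At the first difference only one orientation is read; by symmetry of [E] either gives the same
    answer. *)
Lemma embedding_reduction : is_reduction E (universal_graph q) embedding.
Proof.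
have /clopen_graphP[symE irrE _] := cE.
move=> x y; rewrite /universal_graph /=.
have [->|nxy] := pselect (x = y).
  by split=> [/irrE//|[] [n [_]]]; rewrite ltnn.
have nexy : embedding x <> embedding y by move/(can_inj embeddingK).
have [n e nxyn] := first_difference nexy.
rewrite (universal_arrowE q e nxyn).
rewrite (universal_arrowE q (esym e) (nesym nxyn)).
rewrite (reaches_edge_embedding nxyn) (reaches_edge_embedding (nesym nxyn)).
split=> [Exy|[[_ //]|[_ /symE//]]].
by case: (ltngtP (embedding x n) (embedding y n)) => // _; [left|right; split=> //;
  exact: symE].
Qed.

End Embedding.

Lemma omega1_universal_family :
  exists U : omega1 -> set (baire_space * baire_space),
    (forall a, clopen_graph (U a)) /\
    (forall E : set (baire_space * baire_space), clopen_graph E ->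
      exists a : omega1, continuously_embeds E (U a)).
Proof.
pose rep (a : omega1) := cid2 (proj2_sig a).
exists (fun a => universal_graph (s2val (rep a))); split=> [a|E cE].
  exact: universal_graph_clopen (s2valP (rep a)).
(* Coding pairs by numbers moves the child relation to [nat], where [wf_omega1] applies. *)
pose pair_of n : seq nat * seq nat := odflt ([::], [::]) (unpickle n).
have wf : well_founded (fun m n => undecided_child E (pair_of m) (pair_of n)).
  move=> n; move: {2}(pair_of n) (erefl (pair_of n)) => p.
  elim/(well_founded_ind (undecided_child_wf cE)): p n => p IH n np.
  by split=> m; rewrite np => pm; exact: (IH (pair_of m) pm m erefl).
have [a aP] := wf_omega1 wf.
have [f fP] := aP _ (s2valP (rep a)) (s2valP' (rep a)).
exists a; have rkP p' p : undecided_child E p' p ->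
    strictly_below (s2val (rep a)) (f (pickle p')) (f (pickle p)).
  by move=> pp; apply: fP; rewrite /pair_of !pickleK.
exists (embedding E (f \o pickle)); first exact: embedding_homeo.
exact: embedding_reduction.
Qed.

Theorem theorem1 :
  (~ exists F : set (set (baire_space * baire_space)),
      [/\ countable F,
          forall E, F E -> clopen_graph E
        & forall E : set (baire_space * baire_space), clopen_graph E ->
            exists2 E', F E' & continuously_reduces E E'])
  /\
  (exists U : omega1 -> set (baire_space * baire_space),
      (forall a : omega1, clopen_graph (U a)) /\
      (forall E : set (baire_space * baire_space), clopen_graph E ->
          exists a : omega1, continuously_embeds E (U a))).
Proof.
split; last exact: omega1_universal_family.
by move=> [F [cF clF]]; exact: no_countable_universal.
Qed.
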